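(* Let $n\ge 1$ be an integer and let $S$ be a spherical two-distance set in $\mathbf{R}^n$ with inner products $a$ and $b$, where $-1\le a,b<1$. That is, $S\subset\mathbf{R}^n$ is a set of unit vectors such that $\langle x,y\rangle\in\{a,b\}$ for all distinct $x,y\in S$. If $a+b\ge 0$, then $$|S|\le \frac{n(n+1)}{2}.$$
   Context: A spherical two-distance set in $\mathbf{R}^n$ with inner products $a$ and $b$ is a set $S$ of unit vectors in $\mathbf{R}^n$, together with real numbers $a,b$ with $-1\le a,b<1$, such that the inner product of any two distinct vectors of $S$ is either $a$ or $b$. *)

(* Defs.v *)
From HB Require Import structures.
From mathcomp Require Import all_boot all_order all_algebra.
From mathcomp Require Import mathcomp_extra boolp classical_sets functions.
From mathcomp Require Import cardinality reals.

Set Implicit Arguments.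
Unset Strict Implicit.
Unset Printing Implicit Defensive.

Import Order.TTheory GRing.Theory Num.Theory.
Local Open Scope classical_set_scope.
Local Open Scope ring_scope.

Definition inner (R : realType) (n : nat) (x y : 'rV[R]_n) : R :=
  \sum_(i < n) x 0 i * y 0 i.

(* The library norm [`|x|] on row vectors is the sup norm, so the Euclidean
   one is defined here. *)
Definition enorm (R : realType) (n : nat) (x : 'rV[R]_n) : R :=
  Num.sqrt (inner x x).

(* No finiteness of [S] is assumed, and [a = b] is allowed. *)
Definition spherical_two_distance_set (R : realType) (n : nat) (a b : R)
    (S : set 'rV[R]_n) : Prop :=
  [/\ -1 <= a < 1,
      -1 <= b < 1,
      forall x, S x -> enorm x = 1 &
      forall x y, S x -> S y -> x <> y -> inner x y = a \/ inner x y = b].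

(* Main.v *)
Require Import Defs.
From mathcomp Require Import all_boot all_order all_algebra.
From mathcomp Require Import mathcomp_extra boolp classical_sets functions.
From mathcomp Require Import cardinality reals.
From mathcomp Require Import ring.

Import Order.TTheory GRing.Theory Num.Theory.
Local Open Scope classical_set_scope.
Local Open Scope card_scope.
Local Open Scope ring_scope.

(** For [u] in [S] consider the symmetric matrix [M_u = u^T u + ab I].  On unit
    vectors its quadratic form is
    [<u,v>^2 + ab = (<u,v> - a)(<u,v> - b) + (a + b) <u,v>], which for [u], [v]
    in [S] equals [(a + b) <u,v> + K delta_uv] with [K = (1 - a)(1 - b) > 0].
    If [sum_u c_u M_u = 0], evaluating at [v], multiplying by [c_v] and summing
    gives [(a + b) |sum_u c_u u|^2 + K sum_v c_v^2 = 0], so [c = 0] as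
    [a + b >= 0].  Hence the [M_u] are linearly independent in the space of
    symmetric matrices, of dimension [n (n + 1) / 2]. *)

Lemma card_lower_pairs (n : nat) :
  #|{: {p : 'I_n * 'I_n | (p.2 <= p.1)%N}}| = ((n * (n + 1)) %/ 2)%N.
Proof.
rewrite card_sig -sum1_card.
rewrite -(pair_big_dep xpredT (fun i j : 'I_n => (j <= i)%N) (fun _ _ => 1%N)) /=.
under eq_bigr => i _.
  rewrite -(big_ord_widen n (fun=> 1%N) (ltn_ord i)) sum1_card card_ord; over.
rewrite -(big_mkord xpredT succn) -(big_add1 _ _ 0 n.+1 xpredT id).
(* [bin2_sum] starts at 0; dropping that zero term leaves the sum from 1 to [n]. *)
have := bin2_sum n.+1; rewrite big_ltn // add0n => ->.
by rewrite bin2 divn2 addn1 mulnC.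
Qed.

(** A symmetric matrix is determined by its entries on and below the diagonal. Listing these as the
    rows of [A] gives more rows than columns, so [A] has a nonzero left kernel vector [c]. *)
Lemma symmetric_lin_dep (F : fieldType) (m n : nat) (M : 'I_m -> 'M[F]_n) :
  (forall k, (M k)^T = M k) -> ((n * (n + 1)) %/ 2 < m)%N ->
  exists2 c : 'rV[F]_m, c != 0 & \sum_k c 0 k *: M k = 0.
Proof.
pose T : finType := {p : 'I_n * 'I_n | (p.2 <= p.1)%N}.
move=> Msym; rewrite -card_lower_pairs -/T => ltTm.
pose A := \matrix_(k < m, t < #|T|) M k (sval (enum_val t)).1 (sval (enum_val t)).2.
have /rowV0Pn[c /sub_kermxP cA0 c0] : kermx A != 0.
  rewrite -mxrank_eq0 mxrank_ker subn_eq0 -ltnNge.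
  exact: leq_ltn_trans (rank_leq_col A) ltTm.
have low (i j : 'I_n) : (j <= i)%N -> (\sum_k c 0 k *: M k) i j = 0.
  move=> le_ji; pose t : T := exist _ (i, j) le_ji.
  move/rowP/(_ (enum_rank t)): cA0; rewrite !mxE summxE => {2}<-.
  by apply: eq_bigr => k _; rewrite !mxE enum_rankK.
exists c => //; apply/matrixP => i j; rewrite [RHS]mxE.
(* Above the diagonal, 0 is replaced by the vanishing mirror entry [(j, i)], and symmetry identifies
   the two. *)
have [|/ltnW] := leqP j i => [/low //|/low <-].
rewrite !summxE; apply: eq_bigr => k _.
by rewrite !mxE -[in LHS]Msym mxE.
Qed.

(** Turns failure of the bound into [N.+1] distinct points, for finite and infinite [S] alike: an
    infinite set contains a copy of the naturals. *)
Lemma card_gt_injection {T : Type} (S : set T) (N : nat) :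
  ~ (S #<= `I_N) ->
  exists2 f : 'I_N.+1 -> T, injective f & forall i, S (f i).
Proof.
move=> nle.
have /card_leP[f] : `I_N.+1 #<= S.
  have [/finite_setP[m Sm]|/infiniteP leS] := pselect (finite_set S).
    rewrite (card_le_eqr Sm) card_le_II ltnNge; apply/negP => lemN.
    by apply: nle; rewrite (card_le_eql Sm) card_le_II.
  exact: card_le_trans (subset_card_le (@subsetT _ _)) leS.
exists (fun i : 'I_N.+1 => val (f (SigSub (mem_set (ltn_ord i : `I_N.+1 i))))).
  move=> i j /val_inj /inj; rewrite !in_setT => /(_ isT isT) /(congr1 val) /=.
  exact: val_inj.
by move=> i; apply: set_mem; exact: valP.
Qed.

Lemma inner_ge0 (R : realType) (n : nat) (x : 'rV[R]_n) : 0 <= inner x x.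
Proof. by apply: sumr_ge0 => k _; rewrite -expr2 sqr_ge0. Qed.

Lemma innerC (R : realType) (n : nat) (x y : 'rV[R]_n) : inner x y = inner y x.
Proof. by apply: eq_bigr => k _; rewrite mulrC. Qed.

Lemma inner_suml (R : realType) (n m : nat) (c : 'I_m -> R)
    (f : 'I_m -> 'rV[R]_n) (y : 'rV[R]_n) :
  inner (\sum_i c i *: f i) y = \sum_i c i * inner (f i) y.
Proof.
rewrite /inner; under [RHS]eq_bigr do rewrite mulr_sumr.
rewrite exchange_big /=; apply: eq_bigr => k _.
by rewrite summxE mulr_suml; apply: eq_bigr => i _; rewrite mxE mulrA.
Qed.

Lemma quadratic_form_rank1_scalar (R : realType) (n : nat) (u v : 'rV[R]_n) (s : R) :
  inner v v = 1 -> (v *m (u^T *m u + s%:M) *m v^T) 0 0 = inner u v ^+ 2 + s.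
Proof.
have innerE (x y : 'rV[R]_n) : (x *m y^T) 0 0 = inner x y.
  by rewrite mxE; apply: eq_bigr => i _; rewrite mxE.
move=> v1; rewrite mulmxDr mulmxDl mxE mul_mx_scalar -scalemxAl [X in _ + X]mxE.
rewrite innerE v1 mulr1 mulmxA -mulmxA mxE big_ord1 !innerE expr2.
by rewrite (innerC _ _ v u).
Qed.

Theorem theorem1 (R : realType) (n : nat) (a b : R) (S : set 'rV[R]_n)
    (hn : (1 <= n)%N)
    (hS : spherical_two_distance_set a b S)
    (hab : 0 <= a + b) :
  S #<= `I_((n * (n + 1)) %/ 2)%N.
Proof.
have [/andP[_ a1] /andP[_ b1] norm1 inner_ab] := hS.
apply: contrapT => /card_gt_injection[f f_inj Sf].
have ff1 i : inner (f i) (f i) = 1.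
  by rewrite -[LHS]sqr_sqrtr ?inner_ge0 // -/(enorm _) norm1 ?expr1n.
pose M i := (f i)^T *m f i + (a * b)%:M.
have [|c c0 cM] := symmetric_lin_dep _ _ _ M _ (ltnSn _).
  by move=> i; rewrite /M linearD /= trmx_mul trmxK tr_scalar_mx.
pose K := (1 - a) * (1 - b).
have K0 : 0 < K by rewrite mulr_gt0 // subr_gt0.
have quad i j :
    (f j *m M i *m (f j)^T) 0 0 = (a + b) * inner (f i) (f j) + K *+ (i == j).
  (* For [i = j] this is [1 + ab = (a + b) + (1 - a)(1 - b)]; otherwise the inner product [t] is a
     root of [t^2 - (a + b) t + ab]. *)
  rewrite quadratic_form_rank1_scalar //; case: eqVneq => [->|ij].
    by rewrite ff1 mulr1n /K; ring.
  have fij : f i <> f j by move/f_inj/eqP; rewrite (negbTE ij).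
  by case: (inner_ab _ _ (Sf i) (Sf j) fij) => ->; rewrite mulr0n; ring.
have rel j : (a + b) * (\sum_i c 0 i * inner (f i) (f j)) + K * c 0 j = 0.
  have : (f j *m (\sum_i c 0 i *: M i) *m (f j)^T) 0 0 = 0.
    by rewrite cM mulmx0 mul0mx mxE.
  rewrite mulmx_sumr mulmx_suml summxE => e; rewrite -[RHS]e.
  under [RHS]eq_bigr do rewrite -scalemxAr -scalemxAl mxE quad mulrDr.
  rewrite big_split /= mulr_sumr; congr (_ + _).
    by apply: eq_bigr => i _; ring.
  rewrite (bigD1 j) //= eqxx mulr1n big1 ?addr0 1?mulrC // => i /negbTE ->.
  by rewrite mulr0n mulr0.
pose w := \sum_i c 0 i *: f i.
have ww : \sum_j c 0 j * \sum_i c 0 i * inner (f i) (f j) = inner w w.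
  by rewrite inner_suml; apply: eq_bigr => j _; rewrite innerC inner_suml.
have tot : (a + b) * inner w w + K * \sum_j c 0 j ^+ 2 = 0.
  rewrite -ww !mulr_sumr -big_split big1 //= => j _.
  have /(congr1 ( *%R (c 0 j))) := rel j; rewrite mulr0 => e.
  by rewrite -[RHS]e; ring.
(* The premise [true] matches the trivial filter in [sumr_ge0] and [psumr_eq0P]. *)
have c2_ge0 j : true -> 0 <= c 0 j ^+ 2 by rewrite sqr_ge0.
have sqc_sum : \sum_j c 0 j ^+ 2 = 0.
  have left_ge0 := mulr_ge0 hab (inner_ge0 _ _ w).
  have right_ge0 := mulr_ge0 (ltW K0) (sumr_ge0 _ c2_ge0).
  (* Two nonnegative terms with sum 0 both vanish; [K > 0] then cancels. *)
  move/eqP: tot; rewrite (paddr_eq0 left_ge0 (right_ge0 _)) => /andP[_].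
  by rewrite mulf_eq0 gt_eqF //= => /eqP.
case/negP: c0; apply/eqP/rowP => j; rewrite mxE; apply/eqP.
by rewrite -sqrf_eq0 (psumr_eq0P c2_ge0 sqc_sum).
Qed.
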